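(* There exists $N$ such that for every even $n\ge N$ there is a game in $L(n,2,60/\sqrt{n})$ with no pure $1/3$-equilibrium. Moreover, such a game can be chosen with all payoffs in $[-1,1]$.
   Context: An $n$-player game $G$ in normal form is given by finite strategy sets $A_1,\dots,A_n$ and payoff functions $f_i:A\to\mathbb{R}$, where $A=\prod_{i=1}^n A_i$; write $a=(a_i,a_{-i})$ with $a_{-i}\in A_{-i}=\prod_{j\ne i}A_j$. On $A_{-i}$ use the metric $\rho(a'_{-i},a''_{-i})=\#\{j\ne i: a'_j\ne a''_j\}$. The Lipschitz constant of $G$ is $\delta(G)=\max|f_i(a_i,a'_{-i})-f_i(a_i,a''_{-i})|$ over all players $i$, all $a_i\in A_i$ and all $a'_{-i},a''_{-i}$ with $\rho(a'_{-i},a''_{-i})=1$. $L(n,m,\delta)$ is the set of games with $n$ players, at most $m$ strategies for every player, and Lipschitz constant at most $\delta$. A pure $\epsilon$-equilibrium is a profile $a\in A$ with $f_i(d,a_{-i})\le f_i(a)+\epsilon$ for all players $i$ and all $d\in A_i$. *)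

(* Defs.v *)
From mathcomp Require Export all_boot all_order all_algebra.
From mathcomp Require Export reals.

Set Implicit Arguments.
Unset Strict Implicit.
Unset Printing Implicit Defensive.

Import Order.TTheory GRing.Theory Num.Theory.
Local Open Scope ring_scope.

(* Strategy sets are required to be nonempty: otherwise there is no profile at
   all, and the absence of equilibria is vacuous. *)
Record game (R : realType) (n : nat) := Game {
  strat : 'I_n -> finType;
  strat_gt0 : forall i, (0 < #|strat i|)%N;
  payoff : 'I_n -> {dffun forall i, strat i} -> R
}.

Section Games.
Variables (R : realType) (n : nat) (G : game R n).

Definition profile := {dffun forall i, strat G i}.

Definition opp_profile (i : 'I_n) :=
  {dffun forall j : {j : 'I_n | j != i}, strat G (val j)}.

Definition opponents (i : 'I_n) (a : profile) : opp_profile i :=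
  [ffun j : {j : 'I_n | j != i} => a (val j)].

(* The profile (d, b), with d played by i and b by the others. *)
Definition combine (i : 'I_n) (d : strat G i) (b : opp_profile i) : profile :=
  [ffun j => match eq_comparable j i with
             | left e => ecast k (strat G k) (esym e) d
             | right ne => b (exist _ j (introN eqP ne))
             end].

Definition rho (i : 'I_n) (b b' : opp_profile i) : nat :=
  #|[set j | b j != b' j]|.

(* A maximum of nonnegative quantities; it is 0 when there is no pair at
   distance 1. *)
Definition lipschitz_constant : R :=
  \big[Num.max/0]_(i < n) \big[Num.max/0]_(x : strat G i)
  \big[Num.max/0]_(b : opp_profile i)
  \big[Num.max/0]_(b' : opp_profile i | rho b b' == 1%N)
    `|payoff i (combine x b) - payoff i (combine x b')|.

(* Membership in L(n, m, delta). *)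
Definition in_L (m : nat) (delta : R) : Prop :=
  (forall i, #|strat G i| <= m)%N /\ lipschitz_constant <= delta.

Definition pure_equilibrium (eps : R) (a : profile) : Prop :=
  forall (i : 'I_n) (d : strat G i),
    payoff i (combine d (opponents i a)) <= payoff i a + eps.

End Games.

(* Main.v *)
(** Write n = 2m and encode strategies by signs. Players i of the first half and
    j of the second half play a zero-sum interaction W i j * x_i * y_j with
    W i j = +-1; the payoff of k is delta/2 * u_k truncated to [-1, 1], where
    u_k is the sum of the interactions of k. As one opponent moves u_k by at
    most 2, the Lipschitz constant is at most delta = 60 / sqrt n.

    In a 1/3-equilibrium every u_k >= - sqrt n / 180, while the u_k sum to 0.
    By counting, W can be chosen so that for each y fewer than half of its rows
    satisfy |<W_i, y>| <= sqrt n / 60: a row does so with probability at most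
    1/16 by the bound C(m, k) <= 2^m / sqrt m, and an exponential moment beats
    the 2^m choices of y. Then more than half of the first players have
    u_i > sqrt n / 60, so the sum of all u_k is positive. *)

Require Import Defs.
From mathcomp Require Import all_boot all_order all_algebra reals.
From mathcomp Require Import zify ring lra.

Set Implicit Arguments.
Unset Strict Implicit.
Unset Printing Implicit Defensive.

Import Order.TTheory GRing.Theory Num.Theory.

Lemma bin_double_le (j k : nat) : 'C(j.*2, k) <= 'C(j.*2, j).
Proof.
have lower d : d <= j -> 'C(j.*2, j - d) <= 'C(j.*2, j).
  elim: d => [|d IHd] ledj; first by rewrite subn0.
  apply: leq_trans (IHd (ltnW ledj)).
  have := mul_bin_left j.*2 (j - d.+1).
  have -> : (j - d.+1).+1 = j - d by lia.
  have : 0 < j - d by lia.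
  nia.
have [lekj | ltjk] := leqP k j; first by rewrite -(subKn lekj) lower ?leq_subr.
have [lek | ltk] := leqP k j.*2; last by rewrite bin_small.
rewrite -bin_sub //; have -> : j.*2 - k = j - (k - j) by lia.
by apply: lower; lia.
Qed.

Lemma central_bin_sqr (j : nat) : 'C(j.*2, j) ^ 2 * j.*2.+1 <= 16 ^ j.
Proof.
elim: j => [//|j IHj].
have rec : 'C(j.+1.*2, j.+1) * j.+1 = 'C(j.*2, j) * (j.*2.+1 * 2).
  have e1 := mul_bin_diag j.*2.+2 j.
  have e2 : 'C(j.*2.+1, j) = 'C(j.*2.+1, j.+1).
    by rewrite -bin_sub; [congr ('C(_, _)); lia | lia].
  have e3 := mul_bin_diag j.*2.+1 j; rewrite /= in e1 e3.
  rewrite doubleS; nia.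
rewrite -(@leq_pmul2r (j.+1 ^ 2)) ?expn_gt0 //.
rewrite mulnAC -expnMn rec (expnS 16 j).
have key : j.*2.+1 * j.+1.*2.+1 * 4 <= 16 * j.+1 ^ 2 by nia.
have := leq_mul IHj key.
move: ('C(_, _)) (16 ^ j) (j.*2.+1) (j.+1.*2.+1) (j.+1 ^ 2) => c P a b d.
by rewrite -!mulnn; lia.
Qed.

Lemma bin_sqr_le (m k : nat) : 'C(m, k) ^ 2 * m <= 4 ^ m.
Proof.
have ce := central_bin_sqr m./2.
have Em := odd_double_half m; set j := m./2 in ce Em.
have E4 : 4 ^ m = 4 ^ odd m * 16 ^ j by rewrite -{1}Em expnD -mul2n expnM.
have le2 : 'C(m, k) <= 2 ^ odd m * 'C(j.*2, j).
  rewrite -{1}Em; case: (odd m) => /=; last by rewrite mul1n bin_double_le.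
  rewrite add1n expn1 mul2n -(addnn 'C(_, _)); case: k => [|k].
    by rewrite bin0 addn_gt0 bin_gt0 -addnn leq_addr.
  by rewrite binS leq_add ?bin_double_le.
have le1 : m <= j.*2.+1 by lia.
apply: leq_trans (leq_mul (leq_mul (leqnn _) (leqnn _)) le1) _.
rewrite E4; apply: (@leq_trans (4 ^ odd m * ('C(j.*2, j) ^ 2 * j.*2.+1))).
  have -> : 4 ^ odd m = (2 ^ odd m) ^ 2 by case: (odd m).
  by rewrite mulnA leq_mul // -expnMn leq_sqr.
by rewrite leq_mul.
Qed.

Definition hamming (m : nat) (v y : {ffun 'I_m -> bool}) : nat :=
  #|[set j | v j != y j]|.

(* For m = n/2 this says |m - 2d| <= sqrt n / 60, the sum of the two truncated
   subtractions being |m - 2d|. *)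
Definition near_half (m d : nat) : bool :=
  1800 * ((m - d.*2) + (d.*2 - m)) ^ 2 <= m.

Lemma card_hamming_eq (m k : nat) (y : {ffun 'I_m -> bool}) :
  #|[set v | hamming v y == k]| = 'C(m, k).
Proof.
have := card_draws 'I_m k; rewrite card_ord => <-.
pose F (v : {ffun 'I_m -> bool}) := [set j | v j != y j].
pose H (A : {set 'I_m}) : {ffun 'I_m -> bool} := [ffun j => (j \in A) (+) y j].
have HK : cancel H F.
  by move=> A; apply/setP=> j; rewrite !inE ffunE; case: (_ \in _); case: (y j).
have FK : cancel F H.
  by move=> v; apply/ffunP=> j; rewrite ffunE inE; case: (v j); case: (y j).
rewrite -(card_imset _ (can_inj HK)); apply: eq_card => v.
rewrite inE; apply/idP/imsetP => [hv | [A]].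
  by exists (F v); rewrite ?FK // inE.
by rewrite inE => hA ->; rewrite /hamming -/(F (H A)) HK.
Qed.

Lemma exists_sqrt_div (a m : nat) : 0 < a ->
  exists t, a * t ^ 2 <= m < a * t.+1 ^ 2.
Proof.
move=> a_gt0; elim: m => [|m [t /andP[le_t lt_t]]].
  by exists 0; rewrite muln0 muln_gt0 a_gt0.
have [le_m | lt_m] := leqP (a * t.+1 ^ 2) m.+1; last first.
  by exists t; rewrite lt_m (leq_trans le_t).
by exists t.+1; rewrite le_m /=; nia.
Qed.

Lemma card_near_half (m : nat) : 2304 <= m ->
  256 * #|[set k : 'I_m.+1 | near_half m k]| ^ 2 <= m.
Proof.
move=> m_big; have [t /andP[le_t lt_t]] := @exists_sqrt_div 1800 m isT.
have le_card : #|[set k : 'I_m.+1 | near_half m k]| <= t.*2.+1.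
  rewrite cardE -(size_map val) -(size_iota ((m - t)./2) t.*2.+1).
  apply: uniq_leq_size; first by rewrite (map_inj_uniq val_inj) enum_uniq.
  move=> _ /mapP[k + ->]; rewrite mem_enum inE /near_half mem_iota /= => nk.
  have : (m - k.*2) + (k.*2 - m) <= t.
    rewrite -ltnS ltnNge; apply/negP => gt.
    have : 1800 * t.+1 ^ 2 <= m by apply: leq_trans nk; rewrite leq_mul // leq_sqr.
    by rewrite leqNgt lt_t.
  have : t <= m by nia.
  lia.
apply: (@leq_trans (256 * t.*2.+1 ^ 2)); first by rewrite leq_mul // leq_sqr.
have [t_le1 | t_gt1] := leqP t 1; last by nia.
apply: leq_trans m_big; rewrite (@leq_mul 256 _ 256 (3 ^ 2)) // leq_sqr; lia.
Qed.

Lemma card_near_rows (m : nat) (y : {ffun 'I_m -> bool}) : 2304 <= m ->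
  16 * #|[set v | near_half m (hamming v y)]| <= 2 ^ m.
Proof.
move=> m_big.
have hlt v : hamming v y < m.+1 by rewrite ltnS -[leqRHS]card_ord max_card.
have [k0 Ek0] : {k0 : 'I_m.+1 | \max_(k < m.+1) 'C(m, k) = 'C(m, k0)}.
  by apply: bigop.eq_bigmax; rewrite card_ord.
have le_card : #|[set v | near_half m (hamming v y)]| <=
    #|[set k : 'I_m.+1 | near_half m k]| * 'C(m, k0).
  rewrite -sum1_card.
  rewrite (partition_big (fun v => Ordinal (hlt v))
    (mem [set k : 'I_m.+1 | near_half m k])) /=; last by move=> v; rewrite !inE.
  rewrite -sum_nat_const; apply: leq_sum => k; rewrite inE => nk.
  rewrite -Ek0; apply: leq_trans (bigop.leq_bigmax k).
  rewrite sum1_card -(card_hamming_eq k y); apply: subset_leq_card.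
  by apply/subsetP => v; rewrite !inE => /andP[_ /eqP <-].
have leC := bin_sqr_le m k0; have leK := card_near_half m_big.
have E4 : (2 ^ m) ^ 2 = 4 ^ m by rewrite -expnM mulnC expnM.
rewrite -leq_sqr E4.
apply: leq_trans leC; apply: leq_trans (leq_mul (leqnn _) leK).
by rewrite mulnCA -expnMn (_ : 256 = 16 ^ 2) // -expnMn leq_sqr leq_mul // mulnC.
Qed.

Lemma exists_balanced_matrix (m : nat) : 2304 <= m ->
  exists W : {ffun 'I_m -> {ffun 'I_m -> bool}}, forall y,
    2 * #|[set i | near_half m (hamming (W i) y)]| < m.
Proof.
move=> m_big; have m_gt0 : 0 < m by apply: leq_trans m_big.
pose row := {ffun 'I_m -> bool}.
pose bad (W : {ffun 'I_m -> row}) y := #|[set i | near_half m (hamming (W i) y)]|.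
have [/existsP[W /forallP goodW] | /existsPn allbad] :=
  boolP [exists W : {ffun 'I_m -> row}, [forall y, 2 * bad W y < m]].
  by exists W.
have card_row : #|{: row}| = 2 ^ m by rewrite card_ffun card_bool card_ord.
(* Double counting of the sum of 16 ^ bad W y: a W without the property
   contributes at least 4 ^ m. *)
have lower : (2 ^ m) ^ m * 4 ^ m <= \sum_(W : {ffun 'I_m -> row}) \sum_y 16 ^ bad W y.
  rewrite -[X in X ^ m * _]card_row -[X in _ ^ X * _](card_ord m) -card_ffun.
  rewrite -sum_nat_const; apply: leq_sum => W _.
  have /forallPn[y] := allbad W; rewrite -leqNgt => le_m.
  rewrite (bigD1 y) //=; apply: leq_trans (leq_addr _ _).
  by rewrite (_ : 16 = 4 ^ 2) // -expnM leq_exp2l.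
have upper y : \sum_(W : {ffun 'I_m -> row}) 16 ^ bad W y < (2 * 2 ^ m) ^ m.
  have -> : \sum_(W : {ffun 'I_m -> row}) 16 ^ bad W y =
      \sum_(W : {ffun 'I_m -> row}) \prod_i 16 ^ near_half m (hamming (W i) y).
    apply: eq_bigr => W _; rewrite -expn_sum; congr (_ ^ _).
    by rewrite /bad -sum1dep_card big_mkcond.
  rewrite -(bigA_distr_bigA (fun _ v => 16 ^ near_half m (hamming v y))).
  rewrite prod_nat_const card_ord ltn_exp2r //.
  have -> : \sum_(v : row) 16 ^ near_half m (hamming v y) =
      2 ^ m + 15 * #|[set v : row | near_half m (hamming v y)]|.
    rewrite -card_row -sum1dep_card -sum1_card big_distrr /= [in RHS]big_mkcond /=.
    rewrite [X in _ + X]big_mkcond -big_split /=.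
    by apply: eq_bigr => v _; case: near_half.
  have leB : 16 * #|[set v : row | near_half m (hamming v y)]| <= 2 ^ m.
    exact: card_near_rows.
  have : 0 < 2 ^ m by rewrite expn_gt0.
  by move: leB; move: #|_| (2 ^ m) => B X; lia.
have : \sum_(W : {ffun 'I_m -> row}) \sum_y 16 ^ bad W y < 2 ^ m * (2 * 2 ^ m) ^ m.
  have X_gt0 : 0 < (2 * 2 ^ m) ^ m by rewrite !(expn_gt0, muln_gt0).
  apply: (@leq_ltn_trans (2 ^ m * ((2 * 2 ^ m) ^ m).-1)); last first.
    by rewrite ltn_pmul2l ?expn_gt0 // prednK.
  rewrite exchange_big /= -[X in _ <= X * _]card_row -sum_nat_const.
  by apply: leq_sum => y _; rewrite -ltnS prednK.
have -> : 2 ^ m * (2 * 2 ^ m) ^ m = (2 ^ m) ^ m * 4 ^ m.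
  by rewrite expnMn mulnA -expnMn mulnC.
by move/(leq_ltn_trans lower); rewrite ltnn.
Qed.

Local Open Scope ring_scope.

Lemma combine_same (R : realType) (n : nat) (G : game R n) (i : 'I_n)
    (d : strat G i) (b : opp_profile G i) :
  combine d b i = d.
Proof.
rewrite ffunE; case: eq_comparable => [e | //].
by rewrite (eq_irrelevance e (erefl i)).
Qed.

Lemma combine_other (R : realType) (n : nat) (G : game R n) (i : 'I_n)
    (d : strat G i) (b : opp_profile G i) (j : {j : 'I_n | j != i}) :
  combine d b (val j) = b j.
Proof.
rewrite ffunE; case: eq_comparable => [e | ne]; first by case: (negP (valP j)); apply/eqP.
by case: j ne => j Pj /= ne; rewrite (bool_irrelevance (introN eqP ne) Pj).
Qed.

Definition clamp (R : realType) (z : R) : R := Num.max (-1) (Num.min 1 z).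

Lemma clamp_itv (R : realType) (z : R) : -1 <= clamp z <= 1.
Proof. by rewrite /clamp /Num.max /Num.min; do !case: ifP => //; lra. Qed.

Lemma clamp_lipschitz (R : realType) (z z' : R) :
  `|clamp z - clamp z'| <= `|z - z'|.
Proof.
wlog le_zz' : z z' / z <= z'.
  by move=> H; case/orP: (le_total z z') => /H; rewrite // distrC [leRHS]distrC.
rewrite [leRHS]ler0_norm ?subr_le0 // ler_norml /clamp /Num.max /Num.min.
by apply/andP; split; do !case: ifP => //; lra.
Qed.

Lemma bool_card_gt0 : (0 < #|{: bool}|)%N.
Proof. by rewrite card_bool. Qed.

Section PolymatrixGame.
Variables (R : realType) (n : nat) (M : 'I_n -> 'I_n -> R) (delta : R).

Definition polymatrix_utility (k : 'I_n) (s : 'I_n -> bool) : R :=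
  \sum_l M k l * (-1) ^+ s k * (-1) ^+ s l.

Definition polymatrix_game : game R n :=
  @Game R n (fun=> bool) (fun=> bool_card_gt0)
    (fun k a => clamp (delta / 2 * polymatrix_utility k a)).

Lemma polymatrix_lipschitz : 0 <= delta -> (forall k l, `|M k l| <= 1) ->
  lipschitz_constant polymatrix_game <= delta.
Proof.
move=> delta_ge0 M_le1.
apply: bigmax_le => // i _; apply: bigmax_le => // x _.
apply: bigmax_le => // b _; apply: bigmax_le => // b' /cards1P[j0 Ej0].
have eq_off l : l != val j0 -> combine x b l = combine x b' l.
  move=> ne_l; case: (eqVneq l i) => [-> | ne_li]; first by rewrite !combine_same.
  pose j : {j : 'I_n | j != i} := exist _ l ne_li.
  have -> : l = val j by []; rewrite !combine_other; apply/eqP/negPn/negP => nb.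
  have : j \in [set j0] by rewrite -Ej0 inE.
  by rewrite inE => /eqP ej; rewrite -ej eqxx in ne_l.
have eq_i : combine x b i = combine x b' i by rewrite !combine_same.
apply: le_trans (clamp_lipschitz _ _) _.
rewrite -mulrBr normrM ger0_norm ?divr_ge0 // /polymatrix_utility -sumrB.
rewrite (bigD1 (val j0)) //= big1 => [|l ne_l]; last by rewrite eq_i eq_off ?subrr.
rewrite addr0 eq_i -mulrBr normrM normrM normr_sign mulr1.
have : `|(-1) ^+ combine x b (val j0) - (-1) ^+ combine x b' (val j0) : R| <= 2.
  by rewrite (le_trans (ler_normB _ _)) // !normr_sign.
have := M_le1 i (val j0); have := normr_ge0 (M i (val j0)).
set p := `|M _ _|; set q := `|_ - _|; move=> p0 p1 q2.
have pq : p * q <= 2 by apply: le_trans q2; rewrite ler_piMl ?normr_ge0.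
by apply: le_trans (ler_wpM2l _ pq) _; lra.
Qed.

Hypothesis M_anti : forall k l, M k l = - M l k.

Lemma sum_polymatrix_utility (s : 'I_n -> bool) :
  \sum_k polymatrix_utility k s = 0.
Proof.
have : \sum_k polymatrix_utility k s = - \sum_k polymatrix_utility k s.
  rewrite /polymatrix_utility [LHS]exchange_big -sumrN; apply: eq_bigr => k _.
  by rewrite -sumrN; apply: eq_bigr => l _; rewrite (M_anti l k) !mulNr mulrAC.
lra.
Qed.

Lemma polymatrix_equilibrium (eps : R) (a : profile polymatrix_game) :
  0 <= eps < 1 -> pure_equilibrium eps a ->
  forall k, - eps <= delta * polymatrix_utility k a.
Proof.
move=> eps_itv eq_a k; have := eq_a k (~~ a k).
set a' := combine _ _; rewrite /payoff /=.
have eq_off l : l != k -> a' l = a l.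
  move=> ne_l; pose j : {j : 'I_n | j != k} := exist _ l ne_l.
  by rewrite (_ : l = val j) // /a' combine_other ffunE.
have eq_k : a' k = ~~ a k by exact: combine_same.
have -> : polymatrix_utility k a' = - polymatrix_utility k a.
  rewrite /polymatrix_utility -sumrN; apply: eq_bigr => l _.
  have [-> | ne_l] := eqVneq l k.
    have -> : M k k = 0 by have := M_anti k k; lra.
    by rewrite !mul0r oppr0.
  by rewrite (eq_off l) // eq_k signrN mulrN mulNr.
move: (polymatrix_utility k a) => u.
rewrite mulrN (_ : delta * u = 2 * (delta / 2 * u)); last by field.
move: (delta / 2 * u) => z.
by rewrite /clamp /Num.max /Num.min; do !case: ifP => //; lra.
Qed.

End PolymatrixGame.

Lemma sum_sign_hamming (R : realType) (m : nat) (v y : {ffun 'I_m -> bool}) :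
  \sum_j (-1) ^+ v j * (-1) ^+ y j = m%:R - 2 * (hamming v y)%:R :> R.
Proof.
have -> : m%:R = \sum_(j < m) 1 :> R by rewrite sumr_const card_ord.
rewrite /hamming -sum1dep_card natr_sum [X in 2 * X]big_mkcond mulr_sumr -sumrB.
by apply: eq_bigr => j _; case: (v j); case: (y j) => /=; ring.
Qed.

Lemma not_near_half (R : realType) (m d : nat) : ~~ near_half m d ->
  m%:R < 1800 * (m%:R - 2 * d%:R) ^+ 2 :> R.
Proof.
have sqr_dist : (m - d.*2 + (d.*2 - m))%:R ^+ 2 = (m%:R - 2 * d%:R) ^+ 2 :> R.
  rewrite natrD -(natrM R 2) mul2n.
  have [le_m | /ltnW le_m] := leqP m d.*2; rewrite (natrB _ le_m).
    by rewrite (eqP (le_m : m - d.*2 == 0)%N) add0r -sqrrN opprB.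
  by rewrite (eqP (le_m : d.*2 - m == 0)%N) addr0.
by rewrite /near_half -ltnNge -(ltr_nat R) natrM natrX sqr_dist.
Qed.

Definition bipartite_matrix (R : realType) (m : nat)
    (W : {ffun 'I_m -> {ffun 'I_m -> bool}}) (k l : 'I_(m + m)) : R :=
  match split k, split l with
  | inl i, inr j => (-1) ^+ W i j
  | inr j, inl i => - (-1) ^+ W i j
  | _, _ => 0
  end.

Lemma bipartite_matrix_anti (R : realType) (m : nat)
    (W : {ffun 'I_m -> {ffun 'I_m -> bool}}) (k l : 'I_(m + m)) :
  bipartite_matrix R W k l = - bipartite_matrix R W l k.
Proof.
by rewrite /bipartite_matrix; case: split; case: split => *; rewrite ?opprK ?oppr0.
Qed.

Lemma bipartite_matrix_le1 (R : realType) (m : nat)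
    (W : {ffun 'I_m -> {ffun 'I_m -> bool}}) (k l : 'I_(m + m)) :
  `|bipartite_matrix R W k l| <= 1.
Proof.
rewrite /bipartite_matrix; case: split; case: split => *;
  by rewrite ?normrN ?normr_sign ?normr0.
Qed.

Lemma bipartite_utility_sqr (R : realType) (m : nat)
    (W : {ffun 'I_m -> {ffun 'I_m -> bool}}) (i : 'I_m) (s : 'I_(m + m) -> bool) :
  polymatrix_utility (bipartite_matrix R W) (lshift m i) s ^+ 2 =
  (m%:R - 2 * (hamming (W i) [ffun j => s (rshift m j)])%:R) ^+ 2.
Proof.
rewrite -sum_sign_hamming /polymatrix_utility big_split_ord /= big1 ?add0r; last first.
  by move=> j _; rewrite /bipartite_matrix !(unsplitK (inl _)) !mul0r.
rewrite (eq_bigr (fun j => (-1) ^+ s (lshift m i) *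
    ((-1) ^+ W i j * (-1) ^+ [ffun j => s (rshift m j)] j))).
  by rewrite -mulr_sumr exprMn sqrr_sign mul1r.
move=> j _; rewrite /bipartite_matrix (unsplitK (inl _)) (unsplitK (inr _)) ffunE.
by rewrite mulrAC mulrC.
Qed.

Theorem theorem2 (R : realType) :
  exists N : nat, forall n : nat, (N <= n)%N -> ~~ odd n ->
    exists G : game R n,
      [/\ in_L G 2 (60%:R / Num.sqrt n%:R),
          ~ (exists a : profile G, pure_equilibrium (1 / 3%:R) a)
        & forall (i : 'I_n) (a : profile G), -1 <= payoff i a <= 1].
Proof.
exists 4608%N => n n_big n_even.
have [m def_n] : exists m, n = (m + m)%N by exists n./2; lia.
subst n; have m_big : (2304 <= m)%N by lia.
have [W goodW] := exists_balanced_matrix m_big.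
set T := Num.sqrt _; pose delta := 60 / T.
have T2 : T ^+ 2 = m%:R + m%:R by rewrite sqr_sqrtr ?natrD ?addr_ge0.
have T_gt0 : 0 < T by rewrite sqrtr_gt0 ltr0n; lia.
have delta_ge0 : 0 <= delta by rewrite divr_ge0 // ltW.
have M_anti := bipartite_matrix_anti R W.
exists (polymatrix_game (bipartite_matrix R W) delta); split.
- split=> [i|]; first by rewrite card_bool.
  exact: polymatrix_lipschitz (bipartite_matrix_le1 R W).
- case=> a eq_a.
  have eps_itv : 0 <= (1 / 3 : R) < 1 by lra.
  have := sum_polymatrix_utility M_anti a.
  have u_ge k : - T / 180 <= polymatrix_utility (bipartite_matrix R W) k a.
    have := polymatrix_equilibrium M_anti eps_itv eq_a k.
    move: (polymatrix_utility _ _ _) => u.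
    rewrite /delta mulrAC ler_pdivlMr //; lra.
  pose bad i := near_half m (hamming (W i) [ffun j => a (rshift m j)]).
  have u_left i : T / 60 - T / 45 * (bad i)%:R <=
      polymatrix_utility (bipartite_matrix R W) (lshift m i) a.
    have := u_ge (lshift m i); have := bipartite_utility_sqr R W i a.
    move: (polymatrix_utility _ _ _) => u u2 u_lo.
    case: (boolP (bad i)) => [_ | /(not_near_half R)]; first by rewrite mulr1; lra.
    rewrite -u2 mulr0 subr0 => u_big; rewrite leNgt; apply/negP => u_hi.
    have : 0 <= (T - 60 * u) * (T + 60 * u) by apply: mulr_ge0; lra.
    lra.
  rewrite big_split_ord /= => sum0.
  have left_ge : m%:R * (T / 60) - T / 45 * #|[set i | bad i]|%:R <=
      \sum_i polymatrix_utility (bipartite_matrix R W) (lshift m i) a.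
    apply: le_trans (ler_sum _ (fun i _ => u_left i)).
    rewrite sumrB sumr_const card_ord -mulr_sumr mulr_natl.
    rewrite -sum1dep_card natr_sum [X in _ - _ * X <= _]big_mkcond.
    by rewrite (eq_bigr (fun i => (bad i)%:R)) // => i; case: (bad i).
  have right_ge : m%:R * (- T / 180) <=
      \sum_i polymatrix_utility (bipartite_matrix R W) (rshift m i) a.
    apply: le_trans (ler_sum _ (fun i _ => u_ge (rshift m i))).
    by rewrite sumr_const card_ord mulr_natl.
  have := goodW [ffun j => a (rshift m j)].
  rewrite -(ltr_nat R) natrM => few_bad.
  have : 0 < (m%:R - 2 * #|[set i | bad i]|%:R) * T by rewrite mulr_gt0 ?subr_gt0.
  lra.
- by move=> i a; apply: clamp_itv.
Qed.
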